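(* Let $A$ be a ring and let $M$ and $N$ be $A$-modules. Let $\Psi$ be the functor from the category $\mathrm{ExMod}(M,N)$ of extensions of $M$ by $N$ to the category of $N$-torsors which sends an extension $(f:P\to M,\ \alpha_f)$ to the $N$-torsor $(f,\tau_f)$ with $\tau_f(n,p)=\alpha_f(n)+p$ for $(n,p)\in N\oplus P$, and which sends each morphism of extensions $h$ to $h$ itself, regarded as a morphism of $N$-torsors. Then $\Psi$ is an equivalence of categories.
   Context: $A$ is a ring with multiplicative identity, not necessarily commutative; ''$A$-module'' means left $A$-module. $M$ and $N$ are fixed $A$-modules. The category of $A$-modules over $M$ has as objects the $A$-module homomorphisms $f:P\to M$, and as morphisms from $f:P\to M$ to $g:Q\to M$ the $A$-module homomorphisms $h:P\to Q$ with $g\circ h=f$. An extension (of $M$ by $N$) is a surjective $A$-module homomorphism $f:P\to M$ together with an isomorphism of $A$-modules $\alpha_f:N\to\ker(f)$. A morphism of extensions from $f:P\to M$ to $g:Q\to M$ is a morphism $h:f\to g$ of $A$-modules over $M$ such that $h(\alpha_f(n))=\alpha_g(n)$ for all $n\in N$. $\mathrm{ExMod}(M,N)$ is the category of extensions and morphisms of extensions. For an object $f:P\to M$ over $M$, $\beta_f:N\oplus P\to M$ denotes the object over $M$ given by $\beta_f(n,p)=f(p)$, and for objects $f:P\to M$, $g:Q\to M$ one puts $P\times_M Q=\{(p,q)\in P\oplus Q : f(p)=g(q)\}$. An $N$-torsor is a surjective $A$-module homomorphism $f:P\to M$ together with a morphism $\tau_f:\beta_f\to f$ of $A$-modules over $M$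 (that is, an $A$-module homomorphism $\tau_f:N\oplus P\to P$ with $f\circ\tau_f=\beta_f$) such that (1) $\tau_f(0,p)=p$ for each $p\in P$; (2) for each $(p_1,p_2)\in P\times_M P$ there exists a unique $n\in N$ with $\tau_f(n,p_2)=p_1$. A morphism of $N$-torsors from $f:P\to M$ to $g:Q\to M$ is a morphism $h:f\to g$ of $A$-modules over $M$ such that $h(\tau_f(n,p))=\tau_g(n,h(p))$ for all $(n,p)\in N\oplus P$. *)

(* Defs.v *)
From HB Require Import structures.
From mathcomp Require Import all_boot all_algebra.
From mathcomp Require Import boolp classical_sets.

Set Implicit Arguments.
Unset Strict Implicit.
Unset Printing Implicit Defensive.

Import GRing.Theory.
Local Open Scope ring_scope.

(* Laws are Leibniz equalities of morphisms; for the categories below they are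
   available through functional extensionality and proof irrelevance. *)
Record category := Category {
  cat_obj :> Type;
  cat_hom : cat_obj -> cat_obj -> Type;
  cat_id : forall x, cat_hom x x;
  cat_comp : forall x y z, cat_hom y z -> cat_hom x y -> cat_hom x z;
  cat_comp1m : forall x y (f : cat_hom x y), cat_comp (cat_id y) f = f;
  cat_compm1 : forall x y (f : cat_hom x y), cat_comp f (cat_id x) = f;
  cat_compA : forall x y z t
      (h : cat_hom z t) (g : cat_hom y z) (f : cat_hom x y),
    cat_comp h (cat_comp g f) = cat_comp (cat_comp h g) f
}.

Record functor (C D : category) := Functor {
  fun_obj :> C -> D;
  fun_map : forall x y : C, cat_hom x y -> cat_hom (fun_obj x) (fun_obj y);
  fun_map1 : forall x : C, fun_map (cat_id x) = cat_id (fun_obj x);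
  fun_mapM : forall (x y z : C) (g : cat_hom y z) (f : cat_hom x y),
    fun_map (cat_comp g f) = cat_comp (fun_map g) (fun_map f)
}.

Definition functor_id (C : category) : functor C C :=
  @Functor C C (fun x => x) (fun _ _ f => f)
    (fun _ => erefl) (fun _ _ _ _ _ => erefl).

Lemma functor_comp_map1 (C D E : category) (G : functor D E) (F : functor C D)
    (x : C) :
  fun_map G (fun_map F (cat_id x)) = cat_id (G (F x)).
Proof. by rewrite !fun_map1. Qed.

Lemma functor_comp_mapM (C D E : category) (G : functor D E) (F : functor C D)
    (x y z : C) (g : cat_hom y z) (f : cat_hom x y) :
  fun_map G (fun_map F (cat_comp g f)) =
  cat_comp (fun_map G (fun_map F g)) (fun_map G (fun_map F f)).
Proof. by rewrite !fun_mapM. Qed.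

Definition functor_comp (C D E : category) (G : functor D E) (F : functor C D)
    : functor C E :=
  @Functor C E (fun x => G (F x)) (fun _ _ f => fun_map G (fun_map F f))
    (functor_comp_map1 G F) (functor_comp_mapM G F).

Record nat_trans (C D : category) (F G : functor C D) := NatTrans {
  nat_comp :> forall x : C, cat_hom (F x) (G x);
  nat_compP : forall (x y : C) (f : cat_hom x y),
    cat_comp (nat_comp y) (fun_map F f) = cat_comp (fun_map G f) (nat_comp x)
}.

Definition is_iso (C : category) (x y : C) (f : cat_hom x y) : Prop :=
  exists g : cat_hom y x, cat_comp g f = cat_id x /\ cat_comp f g = cat_id y.

Definition nat_isomorphic (C D : category) (F G : functor C D) : Prop :=
  exists t : nat_trans F G, forall x, is_iso (t x).

Definition is_equivalence (C D : category) (F : functor C D) : Prop :=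
  exists G : functor D C,
    nat_isomorphic (functor_comp G F) (functor_id C) /\
    nat_isomorphic (functor_comp F G) (functor_id D).

Definition surjective (T U : Type) (f : T -> U) : Prop :=
  forall y, exists x, f x = y.

Definition ker_pred (A : pzRingType) (P M : lmodType A) (f : {linear P -> M})
  : {pred P} := fun p => f p == 0.

Lemma ker_submod_closed (A : pzRingType) (P M : lmodType A)
    (f : {linear P -> M}) : submod_closed (ker_pred f).
Proof.
split; first by rewrite unfold_in /ker_pred linear0.
move=> a u v; rewrite !unfold_in /ker_pred => /eqP fu /eqP fv.
by rewrite linearP fu fv scaler0 addr0.
Qed.

HB.instance Definition _ (A : pzRingType) (P M : lmodType A)
    (f : {linear P -> M}) :=
  GRing.isSubmodClosed.Build A P (ker_pred f) (ker_submod_closed f).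

(* The kernel as a module in its own right, so that an extension can carry an
   isomorphism onto it rather than an injection into the ambient module. *)
Record kernel (A : pzRingType) (P M : lmodType A) (f : {linear P -> M}) :=
  Kernel { ker_val :> P; ker_valP : ker_val \in ker_pred f }.

HB.instance Definition _ (A : pzRingType) (P M : lmodType A)
    (f : {linear P -> M}) := [isSub for @ker_val A P M f].
HB.instance Definition _ (A : pzRingType) (P M : lmodType A)
    (f : {linear P -> M}) := [Choice of kernel f by <:].
HB.instance Definition _ (A : pzRingType) (P M : lmodType A)
    (f : {linear P -> M}) := [SubChoice_isSubLmodule of kernel f by <:].

Record over (A : pzRingType) (M : lmodType A) := Over {
  over_dom : lmodType A;
  over_map :> {linear over_dom -> M}
}.

Record over_hom (A : pzRingType) (M : lmodType A) (f g : over M) := OverHom {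
  over_fun :> {linear over_dom f -> over_dom g};
  over_funP : forall p, g (over_fun p) = f p
}.

Lemma over_hom_ext (A : pzRingType) (M : lmodType A) (f g : over M)
    (h k : over_hom f g) : h =1 k -> h = k.
Proof.
case: h k => h hP [k kP] /= hk.
have E : h = k.
  case: h k hk {hP kP} => h ch [k ck] /= /funext hk.
  move: hk ch ck => -> ch ck; congr GRing.Linear.Pack.
  case: ch => [[a] [b]]; case: ck => [[a'] [b']].
  by rewrite (Prop_irrelevance a a') (Prop_irrelevance b b').
by move: E hP kP => -> hP kP; congr OverHom; exact: Prop_irrelevance.
Qed.

Lemma over_id_subproof (A : pzRingType) (M : lmodType A) (f : over M)
    (p : over_dom f) : f (idfun p) = f p.
Proof. by []. Qed.

Definition over_id (A : pzRingType) (M : lmodType A) (f : over M)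
    : over_hom f f :=
  @OverHom A M f f idfun (@over_id_subproof A M f).

Lemma over_comp_subproof (A : pzRingType) (M : lmodType A) (e f g : over M)
    (k : over_hom f g) (h : over_hom e f) (p : over_dom e) :
  g ((k \o h) p) = e p.
Proof. by rewrite /= !over_funP. Qed.

Definition over_comp (A : pzRingType) (M : lmodType A) (e f g : over M)
    (k : over_hom f g) (h : over_hom e f) : over_hom e g :=
  @OverHom A M e g (k \o h) (over_comp_subproof k h).

(* A bijective linear map is an isomorphism of modules: the inverse of a
   bijective linear map is linear. *)
Record extension (A : pzRingType) (M N : lmodType A) := Extension {
  ext_over :> over M;
  ext_surj : surjective ext_over;
  ext_alpha : {linear N -> kernel ext_over};
  ext_alpha_bij : bijective ext_alpha
}.

Record extension_hom (A : pzRingType) (M N : lmodType A)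
    (f g : extension M N) := ExtensionHom {
  ext_hom :> over_hom f g;
  ext_homP : forall n : N,
    ext_hom (ker_val (ext_alpha f n)) = ker_val (ext_alpha g n)
}.

Lemma extension_hom_ext (A : pzRingType) (M N : lmodType A)
    (f g : extension M N) (h k : extension_hom f g) : h =1 k -> h = k.
Proof.
case: h k => h hP [k kP] /= /over_hom_ext hk.
by move: hk hP kP => -> hP kP; congr ExtensionHom; exact: Prop_irrelevance.
Qed.

Lemma extension_id_subproof (A : pzRingType) (M N : lmodType A)
    (f : extension M N) (n : N) :
  over_id f (ker_val (ext_alpha f n)) = ker_val (ext_alpha f n).
Proof. by []. Qed.

Definition extension_id (A : pzRingType) (M N : lmodType A)
    (f : extension M N) : extension_hom f f :=
  @ExtensionHom A M N f f (over_id f) (extension_id_subproof f).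

Lemma extension_comp_subproof (A : pzRingType) (M N : lmodType A)
    (e f g : extension M N) (k : extension_hom f g) (h : extension_hom e f)
    (n : N) :
  over_comp k h (ker_val (ext_alpha e n)) = ker_val (ext_alpha g n).
Proof. by rewrite /= !ext_homP. Qed.

Definition extension_comp (A : pzRingType) (M N : lmodType A)
    (e f g : extension M N) (k : extension_hom f g) (h : extension_hom e f)
    : extension_hom e g :=
  @ExtensionHom A M N e g (over_comp k h) (extension_comp_subproof k h).

Definition ExMod (A : pzRingType) (M N : lmodType A) : category.
refine (@Category (extension M N) (@extension_hom A M N)
  (@extension_id A M N) (@extension_comp A M N) _ _ _).
- by move=> *; exact: extension_hom_ext.
- by move=> *; exact: extension_hom_ext.
- by move=> *; exact: extension_hom_ext.
Defined.

Definition beta (A : pzRingType) (M N : lmodType A) (f : over M) : over M :=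
  @Over A M (N * over_dom f)%type (f \o snd).

Definition fibre_product (A : pzRingType) (M : lmodType A) (f g : over M)
    : set (over_dom f * over_dom g) :=
  fun pq => f pq.1 = g pq.2.

Record torsor (A : pzRingType) (M N : lmodType A) := Torsor {
  tor_over :> over M;
  tor_surj : surjective tor_over;
  tor_tau : over_hom (beta N tor_over) tor_over;
  tor_tau0 : forall p : over_dom tor_over, tor_tau (0, p) = p;
  tor_tau_trans : forall pq : over_dom tor_over * over_dom tor_over,
    fibre_product pq -> exists! n : N, tor_tau (n, pq.2) = pq.1
}.

Record torsor_hom (A : pzRingType) (M N : lmodType A)
    (f g : torsor M N) := TorsorHom {
  tor_hom :> over_hom f g;
  tor_homP : forall (n : N) (p : over_dom f),
    tor_hom (tor_tau f (n, p)) = tor_tau g (n, tor_hom p)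
}.

Lemma torsor_hom_ext (A : pzRingType) (M N : lmodType A)
    (f g : torsor M N) (h k : torsor_hom f g) : h =1 k -> h = k.
Proof.
case: h k => h hP [k kP] /= /over_hom_ext hk.
by move: hk hP kP => -> hP kP; congr TorsorHom; exact: Prop_irrelevance.
Qed.

Lemma torsor_id_subproof (A : pzRingType) (M N : lmodType A)
    (f : torsor M N) (n : N) (p : over_dom f) :
  over_id f (tor_tau f (n, p)) = tor_tau f (n, over_id f p).
Proof. by []. Qed.

Definition torsor_id (A : pzRingType) (M N : lmodType A)
    (f : torsor M N) : torsor_hom f f :=
  @TorsorHom A M N f f (over_id f) (@torsor_id_subproof A M N f).

Lemma torsor_comp_subproof (A : pzRingType) (M N : lmodType A)
    (e f g : torsor M N) (k : torsor_hom f g) (h : torsor_hom e f)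
    (n : N) (p : over_dom e) :
  over_comp k h (tor_tau e (n, p)) = tor_tau g (n, over_comp k h p).
Proof. by rewrite /= !tor_homP. Qed.

Definition torsor_comp (A : pzRingType) (M N : lmodType A)
    (e f g : torsor M N) (k : torsor_hom f g) (h : torsor_hom e f)
    : torsor_hom e g :=
  @TorsorHom A M N e g (over_comp k h) (torsor_comp_subproof k h).

Definition TorsCat (A : pzRingType) (M N : lmodType A) : category.
refine (@Category (torsor M N) (@torsor_hom A M N)
  (@torsor_id A M N) (@torsor_comp A M N) _ _ _).
- by move=> *; exact: torsor_hom_ext.
- by move=> *; exact: torsor_hom_ext.
- by move=> *; exact: torsor_hom_ext.
Defined.

Definition Psi_tau_fun (A : pzRingType) (M N : lmodType A)
    (f : extension M N) (np : N * over_dom f) : over_dom f :=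
  ker_val (ext_alpha f np.1) + np.2.

Lemma Psi_tau_linear (A : pzRingType) (M N : lmodType A)
    (f : extension M N) : linear (@Psi_tau_fun A M N f).
Proof.
move=> a u v; rewrite /Psi_tau_fun /= linearP /=.
by rewrite scalerDr addrACA.
Qed.

HB.instance Definition _ (A : pzRingType) (M N : lmodType A)
    (f : extension M N) :=
  GRing.isLinear.Build A (N * over_dom f)%type (over_dom f) *:%R
    (@Psi_tau_fun A M N f) (@Psi_tau_linear A M N f).

Lemma ker_val_eq0 (A : pzRingType) (P M : lmodType A) (f : {linear P -> M})
    (x : kernel f) : f (ker_val x) = 0.
Proof. exact/eqP/(ker_valP x). Qed.

Lemma Psi_tau_over (A : pzRingType) (M N : lmodType A) (f : extension M N)
    (np : N * over_dom f) : f (Psi_tau_fun np) = beta N f np.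
Proof. by rewrite linearD ker_val_eq0 add0r. Qed.

Definition Psi_tau (A : pzRingType) (M N : lmodType A) (f : extension M N)
    : over_hom (beta N f) f :=
  @OverHom A M (beta N f) f (@Psi_tau_fun A M N f) (@Psi_tau_over A M N f).

Lemma Psi_tau0 (A : pzRingType) (M N : lmodType A) (f : extension M N)
    (p : over_dom f) : Psi_tau f (0, p) = p.
Proof.
rewrite /= /Psi_tau_fun /= linear0.
by rewrite (_ : ker_val 0 = 0) ?add0r //;
  exact: (linear0 (val : kernel f -> over_dom f)).
Qed.

Lemma Psi_tau_trans (A : pzRingType) (M N : lmodType A) (f : extension M N)
    (pq : over_dom f * over_dom f) :
  fibre_product pq -> exists! n : N, Psi_tau f (n, pq.2) = pq.1.
Proof.
case: pq => p q /= fpq; have [g gK Kg] := ext_alpha_bij f.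
have kpq : p - q \in ker_pred f.
  by rewrite unfold_in /ker_pred linearB fpq subrr.
exists (g (Kernel kpq)); split; first by rewrite /Psi_tau_fun /= Kg /= subrK.
move=> n; rewrite /Psi_tau_fun /= => np.
by rewrite -[n]gK; congr g; apply: val_inj; rewrite /= -np addrK.
Qed.

Definition Psi_obj (A : pzRingType) (M N : lmodType A) (f : extension M N)
    : torsor M N :=
  @Torsor A M N f (ext_surj f) (Psi_tau f) (@Psi_tau0 A M N f)
    (@Psi_tau_trans A M N f).

Lemma Psi_map_subproof (A : pzRingType) (M N : lmodType A)
    (f g : extension M N) (h : extension_hom f g) (n : N) (p : over_dom f) :
  h (tor_tau (Psi_obj f) (n, p)) = tor_tau (Psi_obj g) (n, h p).
Proof. by rewrite /= /Psi_tau_fun linearD /= ext_homP. Qed.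

Definition Psi_map (A : pzRingType) (M N : lmodType A)
    (f g : extension M N) (h : extension_hom f g)
    : torsor_hom (Psi_obj f) (Psi_obj g) :=
  @TorsorHom A M N (Psi_obj f) (Psi_obj g) h (Psi_map_subproof h).

Definition Psi (A : pzRingType) (M N : lmodType A)
    : functor (ExMod M N) (TorsCat M N).
refine (@Functor (ExMod M N) (TorsCat M N) (@Psi_obj A M N)
  (@Psi_map A M N) _ _).
- by move=> f; exact: torsor_hom_ext.
- by move=> e f g k h; exact: torsor_hom_ext.
Defined.

(* Main.v *)
(** A linear torsor action is a translation:
    [tau (n, p) = tau (n, 0) + tau (0, p) = tau (n, 0) + p], and
    [n |-> tau (n, 0)] is linear with values in the kernel.  Applying the torsor
    axiom to the pairs [(k, 0)], with [k] in the kernel, shows that it is an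
    isomorphism onto the kernel.  The extension so obtained defines an inverse
    of Psi, both natural isomorphisms being identities of underlying modules. *)
Require Import Defs.
From HB Require Import structures.
From mathcomp Require Import all_boot all_algebra.
From mathcomp Require Import boolp.

Set Implicit Arguments.
Unset Strict Implicit.
Unset Printing Implicit Defensive.

Import GRing.Theory.
Local Open Scope ring_scope.

Lemma tor_tauE (A : pzRingType) (M N : lmodType A) (t : torsor M N)
    (n : N) (p : over_dom t) : tor_tau t (n, p) = tor_tau t (n, 0) + p.
Proof.
rewrite -{2}(tor_tau0 p) -linearD; congr (tor_tau t _).
by apply/pair_equal_spec; rewrite /= addr0 add0r.
Qed.

Lemma tor_tau_ker (A : pzRingType) (M N : lmodType A) (t : torsor M N)
    (n : N) : tor_tau t (n, 0) \in ker_pred t.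
Proof. by rewrite unfold_in /ker_pred over_funP /= linear0. Qed.

Definition tor_alpha (A : pzRingType) (M N : lmodType A) (t : torsor M N)
    (n : N) : kernel t := Kernel (tor_tau_ker t n).

Lemma tor_alpha_linear (A : pzRingType) (M N : lmodType A) (t : torsor M N) :
  linear (@tor_alpha A M N t).
Proof.
(* Linearity of the action on pairs suffices: the second coordinate [a *: 0 + 0] vanishes. *)
move=> a m n; apply: val_inj => /=; rewrite -linearP; congr (tor_tau t _).
by apply/pair_equal_spec; rewrite /= scaler0 addr0.
Qed.

HB.instance Definition _ (A : pzRingType) (M N : lmodType A)
    (t : torsor M N) :=
  GRing.isLinear.Build A N (kernel t) *:%R (@tor_alpha A M N t)
    (tor_alpha_linear t).

Lemma tor_alpha_bij (A : pzRingType) (M N : lmodType A) (t : torsor M N) :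
  bijective (@tor_alpha A M N t).
Proof.
(* The pair [(k, 0)] lies in the fibre product because both entries map to 0. *)
have uniq_pre (k : kernel t) : exists! n : N, tor_tau t (n, 0) = ker_val k.
  apply: (@tor_tau_trans _ _ _ t (ker_val k, 0)).
  by rewrite /fibre_product /= ker_val_eq0 linear0.
(* The inverse picks the translation carrying 0 to [k]; its uniqueness gives one cancellation law,
   its defining equation the other. *)
exists (fun k => projT1 (cid (uniq_pre k))) => [n|k]; case: cid => /= m [mk um].
  exact: um.
exact: val_inj.
Qed.

Definition torsor_extension (A : pzRingType) (M N : lmodType A)
    (t : torsor M N) : extension M N :=
  @Extension A M N t (@tor_surj A M N t) (@tor_alpha A M N t) (tor_alpha_bij t).

(** Equivariance at the point 0 suffices, since [h 0 = 0]. *)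
Lemma torsor_extension_homP (A : pzRingType) (M N : lmodType A)
    (s t : torsor M N) (h : torsor_hom s t) (n : N) :
  h (ker_val (ext_alpha (torsor_extension s) n)) =
  ker_val (ext_alpha (torsor_extension t) n).
Proof. by rewrite /= tor_homP linear0. Qed.

Definition torsor_extension_hom (A : pzRingType) (M N : lmodType A)
    (s t : torsor M N) (h : torsor_hom s t)
    : extension_hom (torsor_extension s) (torsor_extension t) :=
  @ExtensionHom A M N (torsor_extension s) (torsor_extension t) h
    (torsor_extension_homP h).

Definition Phi (A : pzRingType) (M N : lmodType A)
    : functor (TorsCat M N) (ExMod M N).
refine (@Functor (TorsCat M N) (ExMod M N) (@torsor_extension A M N)
  (@torsor_extension_hom A M N) _ _).
- by move=> t; exact: extension_hom_ext.
- by move=> r s t k h; exact: extension_hom_ext.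
Defined.

(** Translating 0 by [n] recovers [alpha]. This is the condition for the identity map to be a
    morphism of extensions. *)
Lemma Phi_Psi_alpha (A : pzRingType) (M N : lmodType A) (f : extension M N)
    (n : N) :
  ker_val (ext_alpha (torsor_extension (Psi_obj f)) n) =
  ker_val (ext_alpha f n).
Proof. by rewrite /= /Psi_tau_fun addr0. Qed.

(** The rebuilt action is [tau (n, 0) + p], so the splitting [tor_tauE] makes the identity map
    equivariant. *)
Lemma Psi_Phi_tau (A : pzRingType) (M N : lmodType A) (t : torsor M N)
    (n : N) (p : over_dom t) :
  tor_tau (Psi_obj (torsor_extension t)) (n, p) = tor_tau t (n, p).
Proof. by rewrite [RHS]tor_tauE. Qed.

Lemma Phi_Psi_iso (A : pzRingType) (M N : lmodType A) :
  nat_isomorphic (functor_comp (Phi M N) (Psi M N)) (functor_id (ExMod M N)).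
Proof.
pose c (f : ExMod M N) :
    cat_hom (functor_comp (Phi M N) (Psi M N) f) (functor_id _ f) :=
  @ExtensionHom A M N (torsor_extension (Psi_obj f)) f (over_id f)
    (Phi_Psi_alpha f).
have cP (f g : ExMod M N) (h : cat_hom f g) :
    cat_comp (c g) (fun_map (functor_comp (Phi M N) (Psi M N)) h) =
    cat_comp (fun_map (functor_id _) h) (c f).
  (* Both composites have underlying map [h], as neither functor changes it. *)
  exact: extension_hom_ext.
exists (NatTrans cP) => f.
exists (@ExtensionHom A M N f (torsor_extension (Psi_obj f)) (over_id f)
  (fun n => esym (Phi_Psi_alpha f n))).
by split; exact: extension_hom_ext.
Qed.

Lemma Psi_Phi_iso (A : pzRingType) (M N : lmodType A) :
  nat_isomorphic (functor_comp (Psi M N) (Phi M N)) (functor_id (TorsCat M N)).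
Proof.
pose c (t : TorsCat M N) :
    cat_hom (functor_comp (Psi M N) (Phi M N) t) (functor_id _ t) :=
  @TorsorHom A M N (Psi_obj (torsor_extension t)) t (over_id t)
    (@Psi_Phi_tau A M N t).
have cP (s t : TorsCat M N) (h : cat_hom s t) :
    cat_comp (c t) (fun_map (functor_comp (Psi M N) (Phi M N)) h) =
    cat_comp (fun_map (functor_id _) h) (c s).
  exact: torsor_hom_ext.
exists (NatTrans cP) => t.
(* The inverse is again the identity map, equivariant by the same equation reversed. *)
exists (@TorsorHom A M N t (Psi_obj (torsor_extension t)) (over_id t)
  (fun n p => esym (Psi_Phi_tau n p))).
by split; exact: torsor_hom_ext.
Qed.

Theorem theorem2p14 (A : pzRingType) (M N : lmodType A) :
  is_equivalence (Psi M N).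
Proof. by exists (Phi M N); split; [exact: Phi_Psi_iso | exact: Psi_Phi_iso]. Qed.
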